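(* Let $\Phi=(\varphi_n)_n$ be a frame for $\mathcal H$ with lower frame bound $m_\Phi$ and let $\Psi=(\psi_n)_n$ be a sequence in $\mathcal H$. Let $\mathcal A_1,\mathcal A_2\in B(\mathcal H)$ with $\|Id_{\mathcal H}-\mathcal A_i\|_{\rm op}<1$ ($i=1,2$). If $\Phi$ and $\Psi$ are c-quadratically close with ${\rm q}_0<1$, then for each $\Theta\in\mathrm{ran}_{B(\mathcal H,\ell^2)}(T_\Phi)$ the approximate dual $\Psi^{ad}_{\Theta_{ba}}(\mathcal A_2)$ of $\Psi$ is a best approximation of $\Phi^{ad}_\Theta(\mathcal A_1)$ in $\mathcal{AD}(\Psi)$ and an $\upsilon$-perturbation of $\Phi^{ad}_\Theta(\mathcal A_1)$, where $\Theta_{ba}=P_{\ker(T_\Psi)}U_{\Phi^{ad}_\Theta(\mathcal A_1)}$ and $$\upsilon=\frac{\sqrt{{\rm q}}}{\sqrt{m_\Phi}(1-{\rm q}_0)}\Big(\frac{\|\mathcal A_1\|_{\rm op}}{\sqrt{m_\Phi}}+\|\Theta\|_{\rm op}+\frac{\|\mathcal A_1-\mathcal A_2\|_{\rm op}}{\sqrt{{\rm q}}}\Big).$$ In particular, $$\big\|\Phi^{ad}_0(\mathcal A_1)-\Psi^{ad}_0(\mathcal A_2)\big\|_{\mathfrak{Fr}}\le\frac{1}{\sqrt{m_\Phi}(1-{\rm q}_0)}\left(2\|\mathcal A_1\|_{\rm op}\sqrt{\frac{{\rm q}}{m_\Phi}}+\|\mathcal A_1-\mathcal A_2\|_{\rm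 op}\right).$$
   Context: $\mathcal H$ is a separable Hilbert space, $\ell^2=\ell^2(\mathbb N)$ with canonical orthonormal basis $(\delta_n)_n$. A sequence $\Phi=(\varphi_n)_{n\in\mathbb N}$ in $\mathcal H$ is a frame with (lower, upper) bounds $m_\Phi,M_\Phi>0$ if $m_\Phi\|f\|^2\le\sum_n|\langle f,\varphi_n\rangle|^2\le M_\Phi\|f\|^2$ for all $f\in\mathcal H$; it is a Bessel sequence if the right inequality holds. For a Bessel sequence $\Phi$: $U_\Phi f=(\langle f,\varphi_n\rangle)_n$ (analysis operator $\mathcal H\to\ell^2$), $T_\Phi=U_\Phi^*$ (synthesis operator), $S_\Phi=T_\Phi U_\Phi$ (frame operator), $\|\Phi\|_{\mathfrak{Fr}}:=\|T_\Phi\|_{\rm op}$. Differences of sequences are componentwise. A Bessel sequence $X$ is an $\upsilon$-perturbation of a Bessel sequence $Y$ if $\|T_X-T_Y\|_{\rm op}\le\upsilon$. For a frame $\Phi$, $\mathrm{ran}_{B(\mathcal H,\ell^2)}(T_\Phi):=\{\Theta\in B(\mathcal H,\ell^2):T_\Phi\Theta=0\}$. For $\Theta$ in this set and $\mathcal A\in B(\mathcal H)$ with $\|Id_{\mathcal H}-\mathcal A\|_{\rm op}<1$, $\Phi^{ad}_\Theta(\mathcal A):=\big(\mathcal A^*S_\Phi^{-1}\varphi_n+\Theta^*\delta_n\big)_n$. These are exactly the approximately dual frames of $\Phi$ (Bessel sequences $\Phi^{ad}$ with $\|Id_{\mathcal H}-T_\Phi U_{\Phi^{ad}}\|_{\rm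 op}<1$), the set of which is denoted $\mathcal{AD}(\Phi)$. $P_X$ is the orthogonal projection of $\ell^2$ onto the closed subspace $X$. $\Phi$ and $\Psi$ are quadratically close if ${\rm q}:=\sum_n\|\varphi_n-\psi_n\|^2<\infty$. The frame $\Phi$ and the sequence $\Psi$ are c-quadratically close if they are quadratically close with $m_\Phi\le{\rm q}$ and ${\rm q}_0:=\sum_n\|\varphi_n-\psi_n\|\,\|S_\Phi^{-1}\varphi_n\|<\infty$. (Under ${\rm q}_0<1$, $\Psi$ is a frame.) ''$\Psi^{ad}_{\Theta_{ba}}(\mathcal A_2)$ is a best approximation of $\Phi^{ad}_\Theta(\mathcal A_1)$ in $\mathcal{AD}(\Psi)$'' means: for all $\Lambda\in\mathrm{ran}_{B(\mathcal H,\ell^2)}(T_\Psi)$, $\|\Psi^{ad}_{\Theta_{ba}}(\mathcal A_2)-\Phi^{ad}_\Theta(\mathcal A_1)\|_{\mathfrak{Fr}}\le\|\Psi^{ad}_{\Lambda}(\mathcal A_2)-\Phi^{ad}_\Theta(\mathcal A_1)\|_{\mathfrak{Fr}}$. *)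

(* Defs.v *)
From HB Require Import structures.
From mathcomp Require Import all_boot all_order all_algebra.
From mathcomp Require Import all_classical all_reals all_analysis.
From mathcomp Require Import complex ring lra.

Set Implicit Arguments.
Unset Strict Implicit.
Unset Printing Implicit Defensive.

Import Order.TTheory GRing.Theory Num.Theory.
Import numFieldNormedType.Exports.
Local Open Scope classical_set_scope.
Local Open Scope ring_scope.

(* Hilbert spaces are over the reals or over the complex numbers: scalar_field,
   sconj, sofr, sre, sim are the field, the conjugation, the embedding of the
   reals and the real and imaginary parts in the two cases. *)
Variant scalar_kind := RealScalars | ComplexScalars.

Definition scalar_field (R : realType) (k : scalar_kind) : numFieldType :=
  match k with RealScalars => R | ComplexScalars => R[i] end.

Definition sconj (R : realType) (k : scalar_kind) :
    scalar_field R k -> scalar_field R k :=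
  match k with RealScalars => idfun | ComplexScalars => @conjc R end.

Definition sofr (R : realType) (k : scalar_kind) : R -> scalar_field R k :=
  match k with RealScalars => idfun | ComplexScalars => real_complex R end.

Definition sre (R : realType) (k : scalar_kind) : scalar_field R k -> R :=
  match k with RealScalars => idfun | ComplexScalars => @complex.Re R end.

Definition sim (R : realType) (k : scalar_kind) : scalar_field R k -> R :=
  match k with RealScalars => fun=> 0 | ComplexScalars => @complex.Im R end.

Definition simag (R : realType) (k : scalar_kind) : scalar_field R k :=
  match k with RealScalars => 0 | ComplexScalars => 'i%C end.

Section ScalarTheory.
Context (R : realType) (k : scalar_kind).
Local Notation K := (scalar_field R k).
Implicit Types (x y z : K) (r s : R).

Fact sconj_is_zmod_morphism : zmod_morphism (@sconj R k).
Proof. by case: k => [|] x y //; exact: rmorphB. Qed.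

Fact sconj_is_monoid_morphism : monoid_morphism (@sconj R k).
Proof. by case: k; split=> //; [exact: rmorph1|exact: rmorphM]. Qed.

HB.instance Definition _ :=
  GRing.isZmodMorphism.Build K K (@sconj R k) sconj_is_zmod_morphism.
HB.instance Definition _ :=
  GRing.isMonoidMorphism.Build K K (@sconj R k) sconj_is_monoid_morphism.

Lemma sconjK : involutive (@sconj R k).
Proof. by case: k => [|] x //; exact: conjcK. Qed.

Fact sofr_is_zmod_morphism : zmod_morphism (@sofr R k).
Proof. by case: k => [|] x y //; exact: rmorphB. Qed.

Fact sofr_is_monoid_morphism : monoid_morphism (@sofr R k).
Proof. by case: k; split=> // x y; exact: rmorphM. Qed.

HB.instance Definition _ :=
  GRing.isZmodMorphism.Build R K (@sofr R k) sofr_is_zmod_morphism.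
HB.instance Definition _ :=
  GRing.isMonoidMorphism.Build R K (@sofr R k) sofr_is_monoid_morphism.

Fact sre_is_zmod_morphism : zmod_morphism (@sre R k).
Proof. by case: k => [|] // [? ?] [? ?]. Qed.

Fact sim_is_zmod_morphism : zmod_morphism (@sim R k).
Proof. by case: k => [x y|[? ?] [? ?]//]; rewrite /= subr0. Qed.

HB.instance Definition _ :=
  GRing.isZmodMorphism.Build K R (@sre R k) sre_is_zmod_morphism.
HB.instance Definition _ :=
  GRing.isZmodMorphism.Build K R (@sim R k) sim_is_zmod_morphism.

Lemma sofrK r : sre (sofr k r) = r. Proof. by case: k. Qed.

Lemma sofr_ler r s : (sofr k r <= sofr k s) = (r <= s).
Proof. by case: k => //; exact: lecR. Qed.

Lemma sofr_ltr r s : (sofr k r < sofr k s) = (r < s).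
Proof. by case: k => //; exact: ltcR. Qed.

Lemma sreK z : 0 <= z -> sofr k (sre z) = z.
Proof. by move: z; case: k => [|z z0] //=; apply/RRe_real/ger0_real. Qed.

Lemma sre_ge0 z : 0 <= z -> 0 <= sre z.
Proof. by move=> z0; rewrite -sofr_ler sreK// rmorph0. Qed.

Lemma scalarE z : z = sofr k (sre z) + sofr k (sim z) * simag R k.
Proof.
by move: z; case: k => [z|z] /=; [rewrite mulr0 addr0|rewrite mulrC; exact: complexE].
Qed.

Lemma sofr_norm r : `|sofr k r| = sofr k `|r|.
Proof.
by case: k => //=; rewrite normc_def/= expr0n/= addr0 sqrtr_sqr.
Qed.

Lemma sre_norm z : `|sre z| <= sre `|z|.
Proof.
by move: z; case: k => [//|z]; have := normc_ge_Re z; rewrite lecE/= => /andP[].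
Qed.

Lemma sim_norm z : `|sim z| <= sre `|z|.
Proof.
move: z; case: k => [z|[a b]]/=; first by rewrite normr0.
suff: `|b| <= complex.Re `|(a +i* b)%C : R[i]| by [].
by rewrite normc_def/= -sqrtr_sqr ler_wsqrtr// lerDr sqr_ge0.
Qed.

Lemma sqr_snorm z : `|z| ^+ 2 = z * sconj z.
Proof.
move: z; case: k => [z|z]/=; last exact: sqr_normc.
by rewrite real_normK ?num_real.
Qed.

Lemma snorm_conj z : `|sconj z| = `|z|.
Proof. by move: z; case: k => [//|z]; exact: normcJ. Qed.

Lemma sconj_sofr r : sconj (sofr k r) = sofr k r.
Proof. by case: k => //; exact: conjc_real. Qed.

Lemma sre_conj z : sre (sconj z) = sre z.
Proof. by move: z; case: k => // -[]. Qed.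

Lemma sre_ofM r z : sre (sofr k r * z) = r * sre z.
Proof. by move: z; case: k => // -[a b] /=; rewrite mul0r subr0. Qed.

End ScalarTheory.

(* Inner products are linear in the first argument. *)
HB.mixin Record NormedModule_hasInner (R : realType) (k : scalar_kind) E
    & NormedModule (scalar_field R k) E := {
  inner : {dot E for @sconj R k} ;
  sqr_norm_inner : forall x : E, `|x| ^+ 2 = inner x x
}.

#[short(type="innerType")]
HB.structure Definition InnerProductSpace (R : realType) (k : scalar_kind) :=
  {E of NormedModule (scalar_field R k) E & NormedModule_hasInner R k E}.

#[short(type="hilbertType")]
HB.structure Definition HilbertSpace (R : realType) (k : scalar_kind) :=
  {E of InnerProductSpace R k E & Complete E}.

Notation "''[' x , y ]" := (inner x y) : ring_scope.

Section DotNorm.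
Context (R : realType) (k : scalar_kind) (E : lmodType (scalar_field R k)).
Variable f : {dot E for @sconj R k}.

Let n2 (x : E) : R := sre (f x x).

Lemma dot_ge0 x : 0 <= f x x.
Proof.
have [->|x0] := eqVneq x 0; first by rewrite linear0l.
exact/ltW/neq0_dnorm_gt0.
Qed.

Lemma dotC x y : f x y = sconj (f y x).
Proof. by rewrite hermitian_subproof expr0 mul1r. Qed.

Lemma dotZl a x y : f (a *: x) y = a * f x y.
Proof. by rewrite linearZl_LR. Qed.

Lemma dotZr a x y : f x (a *: y) = sconj a * f x y.
Proof. by rewrite linearZr_LR. Qed.

Lemma sre_dotDZ (t : R) x y :
  n2 (x + sofr k t *: y) = n2 x + t * sre (f x y) *+ 2 + t ^+ 2 * n2 y.
Proof.
rewrite /n2 linearDl !linearDr/= !dotZl !dotZr sconj_sofr !raddfD/= !sre_ofM.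
by rewrite [f y x]dotC sre_conj; ring.
Qed.

Lemma dot_CS x y : sre (f x y) <= Num.sqrt (n2 x) * Num.sqrt (n2 y).
Proof.
have n20 z : 0 <= n2 z by apply: sre_ge0; exact: dot_ge0.
have [y0|y0] := eqVneq y 0.
  by rewrite y0 linear0r raddf0 mulr_ge0 ?sqrtr_ge0.
have n2y : 0 < n2 y.
  by rewrite -(sofr_ltr k) rmorph0 sreK ?dot_ge0// neq0_dnorm_gt0.
rewrite -sqrtrM// (le_trans (ler_norm _))// -sqrtr_sqr ler_wsqrtr//.
have := n20 (x + sofr k (- (sre (f x y) / n2 y)) *: y).
rewrite sre_dotDZ => h; rewrite -ler_pdivrMr//.
rewrite -subr_ge0; apply: le_trans h _; rewrite le_eqVlt; apply/orP; left; apply/eqP.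
field; exact: lt0r_neq0.
Qed.

Definition dot_norm (x : E) : scalar_field R k := sofr k (Num.sqrt (n2 x)).

Lemma ler_dot_normD x y : dot_norm (x + y) <= dot_norm x + dot_norm y.
Proof.
have n20 z : 0 <= n2 z by apply: sre_ge0; exact: dot_ge0.
rewrite -rmorphD sofr_ler -[leRHS]ger0_norm ?addr_ge0 ?sqrtr_ge0//.
rewrite -sqrtr_sqr ler_wsqrtr// sqrrD !sqr_sqrtr//.
have := sre_dotDZ 1 x y; rewrite rmorph1 scale1r expr1n !mul1r => ->.
by rewrite lerD2r lerD2l lerMn2r dot_CS.
Qed.

Lemma dot_normZ a x : dot_norm (a *: x) = `|a| * dot_norm x.
Proof.
rewrite /dot_norm /n2 dotZl dotZr mulrA -sqr_snorm.
rewrite -[`|a|]sreK// -rmorphXn/= sre_ofM sqrtrM ?sqr_ge0// sqrtr_sqr.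
by rewrite rmorphM/= ger0_norm ?sre_ge0.
Qed.

Lemma dot_norm_eq0 x : dot_norm x = 0 -> x = 0.
Proof.
move=> /(congr1 (@sre R k)); rewrite sofrK raddf0 => /eqP.
rewrite sqrtr_eq0 => h; apply/eqP; apply: contraTT h => x0.
by rewrite -ltNge -(sofr_ltr k) rmorph0 sreK ?dot_ge0// neq0_dnorm_gt0.
Qed.

Lemma sqr_dot_norm x : dot_norm x ^+ 2 = f x x.
Proof.
by rewrite -rmorphXn/= sqr_sqrtr ?sreK ?dot_ge0//; apply: sre_ge0; exact: dot_ge0.
Qed.

End DotNorm.

HB.factory Record Lmodule_hasInner (R : realType) (k : scalar_kind) E
    & GRing.Lmodule (scalar_field R k) E := {
  dot : {dot E for @sconj R k}
}.

HB.builders Context R k E & Lmodule_hasInner R k E.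

HB.instance Definition _ := Lmodule_isNormed.Build (scalar_field R k) E
  (ler_dot_normD dot) (dot_normZ dot) (@dot_norm_eq0 _ _ _ dot).

HB.instance Definition _ := NormedModule_hasInner.Build R k E
  (sqr_dot_norm dot).

HB.end.

(* The norm of a normed module over K takes its values in K; rnorm is the same
   norm as an element of R. *)
Definition rnorm (R : realType) (k : scalar_kind)
  (V : normedModType (scalar_field R k)) (v : V) : R := sre `|v|.

Section ScalarSeries.
Context (R : realType) (k : scalar_kind).
Local Notation K := (scalar_field R k).

Lemma nneseries_ltyP (u : nat -> R) : (forall n, 0 <= u n) ->
  (\sum_(0 <= n <oo) (u n)%:E < +oo)%E <-> cvgn (series u).
Proof.
move=> u0; split=> [h|h]; last first.
  have -> : (\sum_(0 <= n <oo) (u n)%:E = (limn (series u))%:E)%E.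
    by rewrite -EFin_lim//; congr (limn _); apply/funext => n; rewrite sumEFin.
  exact: ltry.
apply: nondecreasing_is_cvgn; first exact: nondecreasing_series.
exists (fine (\sum_(0 <= n <oo) (u n)%:E)%E) => _ [n _ <-].
rewrite -lee_fin fineK.
  rewrite -sumEFin; apply: nneseries_lim_ge => i _ _.
  by rewrite lee_fin.
rewrite ge0_fin_numE//; apply: nneseries_ge0 => i _ _.
by rewrite lee_fin.
Qed.

Lemma cvgn_sofr (u : nat -> R) l : u n @[n --> \oo] --> l ->
  sofr k (u n) @[n --> \oo] --> sofr k l.
Proof.
move=> /cvgrPdist_lt h; apply/cvgrPdist_lt => e e0.
have e'0 : 0 < sre e by rewrite -(sofr_ltr k) rmorph0 sreK ?ltW.
near=> n; rewrite -rmorphB/= sofr_norm -[e]sreK ?ltW// sofr_ltr.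
by near: n; exact: h.
Unshelve. all: by end_near. Qed.

Lemma cvgn_sconj (u : nat -> K) l : u n @[n --> \oo] --> l ->
  sconj (u n) @[n --> \oo] --> sconj l.
Proof.
move=> /cvgrPdist_lt h; apply/cvgrPdist_lt => e e0.
near=> n; rewrite -rmorphB/= snorm_conj.
by near: n; exact: h.
Unshelve. all: by end_near. Qed.

Lemma scalar_abs_cvg (u : nat -> K) :
  cvgn (series (fun n => rnorm (u n))) -> cvgn (series u).
Proof.
move=> cu.
have cv (f : K -> R) : (forall z, `|f z| <= sre `|z|) ->
    cvgn (series (fun n => f (u n))).
  move=> fle; apply: normed_cvg.
  apply: series_le_cvg cu => n; first exact: normr_ge0.
    exact: sre_ge0.
  exact: fle.
have -> : series u = (fun n => sofr k (series (fun n => sre (u n)) n) +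
                               sofr k (series (fun n => sim (u n)) n) * simag R k).
  apply/funext => n; rewrite /series/= !raddf_sum mulr_suml -big_split/=.
  by apply: eq_bigr => i _; exact: scalarE.
apply: is_cvgD.
  by apply/cvg_ex; eexists; apply: cvgn_sofr; exact: (cv _ (@sre_norm R k)).
apply: is_cvgM; last exact: is_cvg_cst.
by apply/cvg_ex; eexists; apply: cvgn_sofr; exact: (cv _ (@sim_norm R k)).
Qed.

End ScalarSeries.

Definition square_summable (R : realType) (k : scalar_kind)
    (x : nat -> scalar_field R k) : Prop :=
  (\sum_(0 <= n <oo) ((rnorm (x n)) ^+ 2)%:E < +oo)%E.

Definition l2_pred (R : realType) (k : scalar_kind) :
  {pred nat -> scalar_field R k} := [pred x | `[< square_summable x >]].

Section L2.
Context (R : realType) (k : scalar_kind).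
Local Notation K := (scalar_field R k).

Lemma rnorm_ge0 (V : normedModType K) (v : V) : 0 <= rnorm v.
Proof. exact: sre_ge0. Qed.

Lemma rnormK (V : normedModType K) (v : V) : sofr k (rnorm v) = `|v|.
Proof. exact: sreK. Qed.

Lemma ler_rnormD (V : normedModType K) (v w : V) :
  rnorm (v + w) <= rnorm v + rnorm w.
Proof. by rewrite -(sofr_ler k) rmorphD/= !rnormK ler_normD. Qed.

Lemma rnormZ (V : normedModType K) (a : K) (v : V) :
  rnorm (a *: v) = rnorm a * rnorm v.
Proof. by rewrite {1}/rnorm normrZ -[`|a|]rnormK sre_ofM. Qed.

Lemma rnormM (a b : K) : rnorm (a * b) = rnorm a * rnorm b.
Proof. by rewrite {1}/rnorm normrM -[`|a|]rnormK sre_ofM. Qed.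

Lemma square_summableP (x : nat -> K) :
  square_summable x <-> cvgn (series (fun n => rnorm (x n) ^+ 2)).
Proof. by apply: nneseries_ltyP => n; exact: sqr_ge0. Qed.

Fact l2_submod_closed : submod_closed (@l2_pred R k).
Proof.
split=> [|a x y].
  apply/asboolP/square_summableP.
  rewrite (_ : series _ = cst 0); first exact: is_cvg_cst.
  apply/funext => n; rewrite /series/= big1// => i _.
  by rewrite /rnorm normr0 raddf0 expr0n.
move=> /asboolP/square_summableP cx /asboolP/square_summableP cy.
apply/asboolP/square_summableP.
pose u := (rnorm a ^+ 2 *+ 2) *: (fun n => rnorm (x n) ^+ 2 : R) +
          (2 : R) *: (fun n => rnorm (y n) ^+ 2 : R).
apply: (@series_le_cvg _ _ u); last first.
- by apply: is_cvg_seriesD; exact: is_cvg_seriesZ.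
- move=> n; apply: (@le_trans _ _ ((rnorm a * rnorm (x n) + rnorm (y n)) ^+ 2)).
    rewrite ler_sqr ?nnegrE ?addr_ge0 ?mulr_ge0 ?rnorm_ge0//.
    by rewrite -rnormM ler_rnormD.
  rewrite /u [leRHS]/= -[leRHS]/(rnorm a ^+ 2 *+ 2 * rnorm (x n) ^+ 2 + 2 * rnorm (y n) ^+ 2).
  have := sqr_ge0 (rnorm a * rnorm (x n) - rnorm (y n)).
  move=> h; rewrite -subr_ge0; apply: le_trans h _.
  by rewrite le_eqVlt; apply/orP; left; apply/eqP; ring.
- move=> n; rewrite -[leRHS]/(rnorm a ^+ 2 *+ 2 * rnorm (x n) ^+ 2 + 2 * rnorm (y n) ^+ 2).
  by rewrite addr_ge0// mulr_ge0// ?mulrn_wge0// sqr_ge0.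
- by move=> n; exact: sqr_ge0.
Qed.

HB.instance Definition _ :=
  GRing.isSubmodClosed.Build K (nat -> K) (@l2_pred R k) l2_submod_closed.

End L2.

Record l2 (R : realType) (k : scalar_kind) := L2 {
  l2_val :> nat -> scalar_field R k ;
  l2_valP : l2_val \in @l2_pred R k
}.

HB.instance Definition _ (R : realType) (k : scalar_kind) :=
  [isSub for @l2_val R k].
HB.instance Definition _ (R : realType) (k : scalar_kind) :=
  [Choice of l2 R k by <:].
HB.instance Definition _ (R : realType) (k : scalar_kind) :=
  [SubChoice_isSubLmodule of l2 R k by <:].

Definition l2_inner (R : realType) (k : scalar_kind) (x y : l2 R k) :
  scalar_field R k := limn (series (fun n => x n * sconj (y n))).

Section L2Inner.
Context (R : realType) (k : scalar_kind).
Local Notation K := (scalar_field R k).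
Implicit Types x y z : l2 R k.

Lemma l2_summable x : square_summable x.
Proof. by have /asboolP := l2_valP x. Qed.

Lemma l2_cvg x : cvgn (series (fun n => rnorm (x n) ^+ 2)).
Proof. exact/square_summableP/l2_summable. Qed.

Lemma l2_inner_cvg x y : cvgn (series (fun n => x n * sconj (y n))).
Proof.
apply: scalar_abs_cvg.
pose u := (fun n => rnorm (x n) ^+ 2 : R) + (fun n => rnorm (y n) ^+ 2 : R).
apply: (@series_le_cvg _ _ u) => [n|n|n|]; first exact: rnorm_ge0.
- by rewrite addr_ge0// sqr_ge0.
- rewrite rnormM -[leRHS]/(rnorm (x n) ^+ 2 + rnorm (y n) ^+ 2).
  rewrite [rnorm (sconj _)](_ : _ = rnorm (y n)); last by rewrite /rnorm snorm_conj.
  have := sqr_ge0 (rnorm (x n) - rnorm (y n)).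
  have : 0 <= rnorm (x n) * rnorm (y n) by rewrite mulr_ge0 ?rnorm_ge0.
  by nra.
- by apply: is_cvg_seriesD; exact: l2_cvg.
Qed.

Fact l2_innerC x y : l2_inner x y = (-1) ^+ false * sconj (l2_inner y x).
Proof.
rewrite expr0 mul1r /l2_inner; apply: cvg_lim => //.
have /cvgn_sconj := @l2_inner_cvg y x; apply: cvg_trans.
apply: near_eq_cvg; near=> n; rewrite /series/= rmorph_sum.
by apply: eq_bigr => i _; rewrite rmorphM/= sconjK mulrC.
Unshelve. all: by end_near. Qed.

Lemma l2_innerDl y : {morph (@l2_inner R k)^~ y : x z / x - z}.
Proof.
move=> x z; rewrite /l2_inner -lim_seriesB; [|exact: l2_inner_cvg..].
congr (limn (series _)); apply/funext => n.
by rewrite -[LHS]/((x n - z n) * _) mulrBl.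
Qed.

Lemma l2_innerZl y : scalable_for *%R ((@l2_inner R k)^~ y).
Proof.
move=> a x; rewrite /l2_inner.
transitivity (a *: limn (series (fun n => x n * sconj (y n)))) => //.
rewrite -lim_seriesZ; last exact: l2_inner_cvg.
congr (limn (series _)); apply/funext => n.
by rewrite -[LHS]/((a * x n) * _) -mulrA.
Qed.

Fact l2_innerDr x : zmod_morphism (@l2_inner R k x).
Proof.
move=> y z; rewrite l2_innerC l2_innerDl rmorphB/= mulrBr.
by rewrite -!l2_innerC.
Qed.

Fact l2_innerZr x : scalable_for (@sconj R k \; *%R) (@l2_inner R k x).
Proof.
move=> a y; rewrite l2_innerC l2_innerZl rmorphM/= mulrCA.
by rewrite -l2_innerC.
Qed.

HB.instance Definition _ :=
  isBilinear.Build K (l2 R k) (l2 R k) K *%R (@sconj R k \; *%R) (@l2_inner R k)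
    l2_innerDl l2_innerDr l2_innerZl l2_innerZr.

HB.instance Definition _ :=
  isHermitianSesquilinear.Build K (l2 R k) false (@sconj R k) (@l2_inner R k)
    l2_innerC.

Lemma l2_innerE x :
  l2_inner x x = sofr k (limn (series (fun n => rnorm (x n) ^+ 2))).
Proof.
apply: cvg_lim => //; have /(@cvgn_sofr R k) := @l2_cvg x; apply: cvg_trans.
apply: near_eq_cvg; near=> n; rewrite /series/= rmorph_sum.
by apply: eq_bigr => i _; rewrite -sqr_snorm -rnormK rmorphXn.
Unshelve. all: by end_near. Qed.

Fact l2_inner_gt0 x : x != 0 -> 0 < l2_inner x x.
Proof.
move=> x0; have [n xn0] : exists n, x n != 0.
  apply: contra_notP (elimN eqP x0) => /forallNP h; apply/val_inj/funext => n.
  by have /negP := h n; rewrite negbK => /eqP.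
rewrite l2_innerE -(rmorph0 (@sofr R k)) sofr_ltr.
apply: (@lt_le_trans _ _ (rnorm (x n) ^+ 2)).
  by rewrite exprn_gt0// -(sofr_ltr k) rmorph0 rnormK normr_gt0.
apply: (@le_trans _ _ (series (fun n => rnorm (x n) ^+ 2) n.+1)).
  rewrite /series/= big_nat_recr//= lerDr sumr_ge0// => i _.
  exact: sqr_ge0.
apply: nondecreasing_cvgn_le; last exact: l2_cvg.
by apply: nondecreasing_series => i _ _; exact: sqr_ge0.
Qed.

HB.instance Definition _ :=
  isDotProduct.Build K (l2 R k) (@l2_inner R k) l2_inner_gt0.

HB.instance Definition _ := Lmodule_hasInner.Build R k (l2 R k)
  (@l2_inner R k : {dot l2 R k for @sconj R k}).

Lemma inner_l2E x y : '[x, y] = l2_inner x y.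
Proof. by []. Qed.

Definition l2_delta_fun (n : nat) : nat -> K := fun i => (i == n)%:R.

Fact l2_delta_subproof n : l2_delta_fun n \in @l2_pred R k.
Proof.
apply/asboolP/square_summableP/cvg_ex; exists 1.
apply: cvg_near_cst; near=> m.
rewrite /series/= (bigD1_seq n)/= ?iota_uniq ?mem_index_iota//=; last first.
  by near: m; exact: nbhs_infty_gt.
rewrite /rnorm /l2_delta_fun eqxx normr1 -(rmorph1 (@sofr R k)) sofrK expr1n.
rewrite big1 ?addr0// => i /negbTE ->; by rewrite normr0 raddf0 expr0n.
Unshelve. all: by end_near. Qed.

Definition l2_delta (n : nat) : l2 R k := L2 (l2_delta_subproof n).

End L2Inner.

Definition separable (T : topologicalType) : Prop :=
  exists D : set T, countable D /\ dense D.

Section Operators.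
Context (R : realType) (k : scalar_kind).
Implicit Types E F : innerType R k.

Definition bounded_operator E F (T : E -> F) : Prop :=
  linear T /\ exists M : R, forall x, rnorm (T x) <= M * rnorm x.

(* As the supremum of a set of reals, this is the operator norm of bounded
   operators only. *)
Definition opnorm E F (T : E -> F) : R :=
  sup [set rnorm (T x) | x in [set x : E | rnorm x <= 1]].

(* When E is complete and T is bounded, adjoint T y is the unique z satisfying
   the condition. *)
Definition adjoint E F (T : E -> F) (y : F) : E :=
  xget 0 [set z | forall x, '[T x, y] = '[x, z]].

Definition ker_op E F (T : E -> F) : set E := [set x | T x = 0].

(* For a closed subspace X of a complete space, orth_proj X y is the unique p
   satisfying the condition. *)
Definition orth_proj E (X : set E) (y : E) : E :=
  xget 0 [set p | X p /\ forall z, X z -> '[y - p, z] = 0].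

Definition inv_op E (T : E -> E) : E -> E := 'pinv_(fun=> 0) setT T.

End Operators.

Section Frames.
Context (R : realType) (k : scalar_kind) (H : hilbertType R k).
Implicit Types (Phi Psi X Y : nat -> H) (A : H -> H) (Theta : H -> l2 R k).
Implicit Types (m M : R).

Definition coef_sum Phi (f : H) : \bar R :=
  (\sum_(0 <= n <oo) ((rnorm '[f, Phi n]) ^+ 2)%:E)%E.

Definition frame_bounds m M Phi : Prop :=
  [/\ 0 < m, 0 < M & forall f,
    ((m * rnorm f ^+ 2)%:E <= coef_sum Phi f <= (M * rnorm f ^+ 2)%:E)%E].

Definition is_frame Phi : Prop := exists m M, frame_bounds m M Phi.

Definition is_bessel Phi : Prop := exists M, 0 < M /\
  forall f, (coef_sum Phi f <= (M * rnorm f ^+ 2)%:E)%E.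

(* For a Bessel sequence the coefficients are square summable and the default
   value of insubd is not used. *)
Definition analysis Phi (f : H) : l2 R k :=
  insubd (0 : l2 R k) (fun n => '[f, Phi n]).

Definition synthesis Phi : l2 R k -> H := adjoint (analysis Phi).

Definition frame_operator Phi : H -> H := synthesis Phi \o analysis Phi.

Definition fr_norm Phi : R := opnorm (synthesis Phi).

Definition perturbation (v : R) X Y : Prop :=
  [/\ is_bessel X, is_bessel Y & opnorm (synthesis X \- synthesis Y) <= v].

Definition ran_synthesis Phi : set (H -> l2 R k) :=
  [set Theta | bounded_operator Theta /\ forall f, synthesis Phi (Theta f) = 0].

Definition approx_dual Phi : set (nat -> H) :=
  [set X | is_bessel X /\ opnorm (idfun \- (synthesis Phi \o analysis X)) < 1].

Definition dual_seq Phi Theta A : nat -> H := fun n =>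
  adjoint A (inv_op (frame_operator Phi) (Phi n)) + adjoint Theta (l2_delta R k n).

Definition best_approx Psi Theta A X : Prop :=
  approx_dual Psi (dual_seq Psi Theta A) /\
  forall Lambda, ran_synthesis Psi Lambda ->
    fr_norm (dual_seq Psi Theta A \- X) <= fr_norm (dual_seq Psi Lambda A \- X).

Definition quad_sum Phi Psi : \bar R :=
  (\sum_(0 <= n <oo) ((rnorm (Phi n - Psi n)) ^+ 2)%:E)%E.

Definition quad0_sum Phi Psi : \bar R :=
  (\sum_(0 <= n <oo)
    (rnorm (Phi n - Psi n) * rnorm (inv_op (frame_operator Phi) (Phi n)))%:E)%E.

Definition quad_close Phi Psi : Prop := (quad_sum Phi Psi < +oo)%E.

Definition c_quad_close m Phi Psi : Prop :=
  [/\ quad_close Phi Psi, (m%:E <= quad_sum Phi Psi)%E &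
      (quad0_sum Phi Psi < +oo)%E].

End Frames.

(* Main.v *)
Require Import Defs.
From HB Require Import structures.
From mathcomp Require Import all_boot all_order all_algebra.
From mathcomp Require Import all_classical all_reals all_analysis.
From mathcomp Require Import ring lra.

Set Implicit Arguments.
Unset Strict Implicit.
Unset Printing Implicit Defensive.

Import Order.TTheory GRing.Theory Num.Theory.
Import numFieldNormedType.Exports.
Local Open Scope classical_set_scope.
Local Open Scope ring_scope.

(** For a Bessel sequence [X] with analysis operator [U] and synthesis operator
    [T = U^*], the norm [fr_norm X] is the operator norm of [U], so the whole
    statement can be read on analysis operators. For a frame, [S = T U] is
    invertible, [G = U S^-1] satisfies [T G = 1], and [1 - G T] is the orthogonal
    projection onto [ker T]. The analysis operator of [dual_seq Phi Theta A] is
    [G A + Theta].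

    [Psi] is a frame ([perturbed_lower_bound]): since [|f|^2 = <U f, G f>],
    replacing the first [U] by the analysis operator of [Psi] costs at most
    [q0 |f|^2], and [|G f| <= |f| / sqrt m]. The lower bound obtained is
    [c' = sqrt m (1 - q0)], hence [|G'| <= 1 / c'], primes denoting the operators
    of [Psi]. Moreover [|U - U'| <= sqrt q] ([quad_close_analysis]).

    Best approximation ([best_approx_proj]): let [V] be the analysis operator of
    the approximate dual to be approximated. The operators
    [G' A2 + Lambda - V], for [Lambda] with values in [ker T'], all have the
    same component [G' (A2 - T' V)] along the range of [U'], and the choice of
    [Lambda] as the projection of [V] onto [ker T'] cancels the component along
    [ker T'].

    Perturbation ([dual_seq_perturbation]): as [T V = A1], the remaining difference
    is [G' (A2 - A1 + (T - T') V)], whose norm is at most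
    [(|A1 - A2| + sqrt q |V|) / c'] with [|V| <= |A1| / sqrt m + |Theta|].

    Canonical duals ([canonical_dual_seq_distance]): here the two operators are
    [G A1] and [G' A2]. Their difference has a component in the range of [U'],
    bounded as before with [Theta = 0], and the component
    [(1 - G' T') G A1 = (1 - G' T') (U - U') S^-1 A1], bounded by
    [sqrt q |A1| / m]; this accounts for the factor 2.

    Adjoints and the surjectivity of [S] both come from minimizing
    [|U x|^2 - 2 Re (l x)] over the Hilbert space, for [U] bounded below and [l] a
    bounded functional ([quadratic_functional_critical]). *)

(** * Inner products and bounded operators *)

Section LinearMaps.
Context (R : realType) (k : scalar_kind).
Local Notation K := (scalar_field R k).
Context (V W : lmodType K) (T : V -> W) (lT : linear T).

Lemma linear_add x y : T (x + y) = T x + T y.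
Proof. by rewrite -[x in LHS]scale1r lT scale1r. Qed.

Lemma linear_sub x y : T (x - y) = T x - T y.
Proof. exact: (zmod_morphism_linear lT). Qed.

Lemma linear_zero : T 0 = 0.
Proof. by rewrite -[0 in LHS](subrr 0) linear_sub subrr. Qed.

Lemma linear_scale a x : T (a *: x) = a *: T x.
Proof. exact: (scalable_linear lT). Qed.

End LinearMaps.

Section InnerProduct.
Context (R : realType) (k : scalar_kind).
Local Notation K := (scalar_field R k).
Implicit Types E F : innerType R k.

Lemma rnorm0 (V : normedModType K) : rnorm (0 : V) = 0.
Proof. by rewrite /rnorm normr0 raddf0. Qed.

Lemma rnorm_eq0 (V : normedModType K) (x : V) : rnorm x = 0 -> x = 0.
Proof. by move=> x0; apply/normr0_eq0; rewrite -rnormK x0 rmorph0. Qed.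

Lemma rnormN (V : normedModType K) (x : V) : rnorm (- x) = rnorm x.
Proof. by rewrite /rnorm normrN. Qed.

Lemma rnorm_conj (a : K) : rnorm (sconj a) = rnorm a.
Proof. by rewrite /rnorm snorm_conj. Qed.

Lemma inner_conj E (x y : E) : '[x, y] = sconj '[y, x].
Proof. exact: dotC. Qed.

Lemma innerDl E (x y z : E) : '[x + y, z] = '[x, z] + '[y, z].
Proof. exact: linearDl. Qed.

Lemma innerBl E (x y z : E) : '[x - y, z] = '[x, z] - '[y, z].
Proof. exact: linearBl. Qed.

Lemma innerDr E (x y z : E) : '[z, x + y] = '[z, x] + '[z, y].
Proof. exact: linearDr. Qed.

Lemma innerBr E (x y z : E) : '[z, x - y] = '[z, x] - '[z, y].
Proof. exact: linearBr. Qed.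

Lemma innerZl E a (x z : E) : '[a *: x, z] = a * '[x, z].
Proof. exact: dotZl. Qed.

Lemma innerZr E a (x z : E) : '[z, a *: x] = sconj a * '[z, x].
Proof. exact: dotZr. Qed.

Lemma inner0r E (z : E) : '[z, 0] = 0.
Proof. exact: linear0r. Qed.

Lemma rnorm_sqr E (x : E) : rnorm x ^+ 2 = sre '[x, x].
Proof. by rewrite -sqr_norm_inner -rnormK -rmorphXn sofrK. Qed.

(** Multiplying [x] by the conjugate of [<x, y>] makes the inner product real, so
    that the bound on real parts applies. *)
Lemma cauchy_schwarz E (x y : E) : rnorm '[x, y] <= rnorm x * rnorm y.
Proof.
have dn (z : E) : Num.sqrt (sre '[z, z]) = rnorm z.
  by rewrite -rnorm_sqr sqrtr_sqr ger0_norm ?rnorm_ge0.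
set a := '[x, y].
have [a0|a0] := eqVneq (rnorm a) 0; first by rewrite a0 mulr_ge0 ?rnorm_ge0.
have a_gt0 : 0 < rnorm a by rewrite lt_neqAle eq_sym a0 rnorm_ge0.
have := dot_CS (inner : {dot E for @sconj R k}) (sconj a *: x) y.
rewrite !dn innerZl -/a mulrC -sqr_snorm -rnormK -rmorphXn sofrK.
by rewrite rnormZ rnorm_conj expr2 -mulrA ler_pM2l.
Qed.

Lemma inner_ext E (x y : E) : (forall z, '[z, x] = '[z, y]) -> x = y.
Proof.
move=> xy; apply/eqP; rewrite -subr_eq0; apply/eqP/rnorm_eq0/eqP.
by rewrite -sqrf_eq0 rnorm_sqr innerBr xy subrr raddf0.
Qed.

Lemma orthogonal_sub_eq0 E (x y z : E) :
  z = x - y -> '[x, z] = 0 -> '[y, z] = 0 -> z = 0.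
Proof.
move=> zE xz yz; apply/rnorm_eq0/eqP; rewrite -sqrf_eq0 rnorm_sqr.
by rewrite {1}zE innerBl xz yz subrr raddf0.
Qed.

Lemma pythagoras E (x y : E) : '[x, y] = 0 ->
  rnorm (x + y) ^+ 2 = rnorm x ^+ 2 + rnorm y ^+ 2.
Proof.
move=> xy; rewrite !rnorm_sqr innerDl !innerDr [ '[y, x] ]inner_conj xy.
by rewrite rmorph0 addr0 add0r raddfD.
Qed.

Lemma ler_rnormB (V : normedModType K) (x y : V) :
  rnorm (x - y) <= rnorm x + rnorm y.
Proof. by rewrite -(rnormN y) ler_rnormD. Qed.

Lemma ler_rnorm_sqr (V W : normedModType K) (x : V) (y : W) b : 0 <= b ->
  rnorm x ^+ 2 <= b * rnorm y * rnorm x -> rnorm x <= b * rnorm y.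
Proof.
move=> b0; have [x0|x0] := eqVneq (rnorm x) 0.
  by rewrite x0 mulr_ge0 ?rnorm_ge0.
by rewrite expr2 ler_pM2r// lt_neqAle eq_sym x0 rnorm_ge0.
Qed.

Lemma opnorm_le E F (T : E -> F) b : 0 <= b ->
  (forall x, rnorm (T x) <= b * rnorm x) -> opnorm T <= b.
Proof.
move=> b0 Tb; apply: ge_sup.
  by exists (rnorm (T 0)), 0 => //=; rewrite rnorm0.
move=> _ [x /= x1 <-]; apply: le_trans (Tb x) _.
by rewrite -[leRHS]mulr1 ler_wpM2l.
Qed.

Lemma opnorm_ub E F (T : E -> F) x : bounded_operator T ->
  rnorm x <= 1 -> rnorm (T x) <= opnorm T.
Proof.
move=> [_ [M TM]] x1; apply: ub_le_sup; last by exists x.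
exists `|M| => _ [y /= y1 <-]; apply: le_trans (TM y) _.
apply: (@le_trans _ _ (`|M| * rnorm y)).
  by rewrite ler_wpM2r ?rnorm_ge0 ?ler_norm.
by rewrite -[leRHS]mulr1 ler_wpM2l.
Qed.

Lemma opnorm_ge0 E F (T : E -> F) : bounded_operator T -> 0 <= opnorm T.
Proof.
move=> bT; apply: le_trans (opnorm_ub (x := 0) bT _); first exact: rnorm_ge0.
by rewrite rnorm0.
Qed.

Lemma ler_opnorm E F (T : E -> F) x : bounded_operator T ->
  rnorm (T x) <= opnorm T * rnorm x.
Proof.
move=> bT; have [lT _] := bT; have [x0|x0] := eqVneq (rnorm x) 0.
  by rewrite (rnorm_eq0 x0) linear_zero// !rnorm0 mulr0.
have x_gt0 : 0 < rnorm x by rewrite lt_neqAle eq_sym x0 rnorm_ge0.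
have nx : rnorm (sofr k (rnorm x)^-1) = (rnorm x)^-1.
  by rewrite /rnorm sofr_norm sofrK ger0_norm ?invr_ge0 ?rnorm_ge0.
rewrite -ler_pdivrMr// mulrC -{1}nx -rnormZ -linear_scale//.
by apply: opnorm_ub => //; rewrite rnormZ nx mulVf.
Qed.

Lemma bounded_operatorP E F (T : E -> F) b : linear T ->
  (forall x, rnorm (T x) <= b * rnorm x) -> bounded_operator T.
Proof. by move=> lT Tb; split=> //; exists b. Qed.

Lemma bounded_operatorB E F (S T : E -> F) :
  bounded_operator S -> bounded_operator T -> bounded_operator (S \- T).
Proof.
move=> bS bT; apply: (@bounded_operatorP _ _ _ (opnorm S + opnorm T)) => [a x y|x] /=.
  by rewrite bS.1 bT.1 scalerBr opprD addrACA.
apply: le_trans (ler_rnormB _ _) _.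
by rewrite mulrDl lerD ?ler_opnorm.
Qed.

Lemma bounded_operatorD E F (S T : E -> F) :
  bounded_operator S -> bounded_operator T -> bounded_operator (S \+ T).
Proof.
move=> bS bT; apply: (@bounded_operatorP _ _ _ (opnorm S + opnorm T)) => [a x y|x] /=.
  by rewrite bS.1 bT.1 scalerDr addrACA.
apply: le_trans (ler_rnormD _ _) _.
by rewrite mulrDl lerD ?ler_opnorm.
Qed.

Lemma bounded_operator_comp E F (G : innerType R k) (S : F -> G) (T : E -> F) :
  bounded_operator S -> bounded_operator T -> bounded_operator (S \o T).
Proof.
move=> bS bT; apply: (@bounded_operatorP _ _ _ (opnorm S * opnorm T)) => [a x y|x] /=.
  by rewrite bT.1 bS.1.
apply: le_trans (ler_opnorm _ bS) _.
by rewrite -mulrA ler_wpM2l ?opnorm_ge0 ?ler_opnorm.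
Qed.

Lemma bounded_operator0 E F : bounded_operator (fun _ : E => 0 : F).
Proof.
apply: (@bounded_operatorP _ _ _ 0) => [a x y|x]; first by rewrite scaler0 addr0.
by rewrite rnorm0 mul0r.
Qed.

Lemma bounded_operator_id E : bounded_operator (idfun : E -> E).
Proof. by apply: (@bounded_operatorP _ _ _ 1) => [//|x]; rewrite mul1r. Qed.

End InnerProduct.

(** * Minimization of quadratic functionals, the Riesz theorem and adjoints *)

Section QuadraticFunctional.
Context (R : realType) (k : scalar_kind).
Local Notation K := (scalar_field R k).
Context (H : hilbertType R k) (F : innerType R k).
Context (U : H -> F) (l : H -> K) (c L : R).
Hypotheses (bU : bounded_operator U) (c_gt0 : 0 < c).
Hypothesis Uc : forall x, c * rnorm x <= rnorm (U x).
Hypotheses (ll : scalar l) (lL : forall x, rnorm (l x) <= L * rnorm x).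

(** The functional to be minimized. *)
Let J (x : H) : R := rnorm (U x) ^+ 2 - 2 * sre (l x).

(** Half the derivative of [J] at [x] in the direction [h]. *)
Let g (x h : H) : R := sre '[U x, U h] - sre (l h).

Let JDZ x (t : R) h :
  J (x + sofr k t *: h) = J x + 2 * t * g x h + t ^+ 2 * rnorm (U h) ^+ 2.
Proof.
rewrite /J /g [x + _]addrC ll [_ + x]addrC (linear_add bU.1) (linear_scale bU.1).
rewrite !rnorm_sqr.
have := sre_dotDZ (inner : {dot F for @sconj R k}) t (U x) (U h).
by move=> /= ->; rewrite raddfD/= sre_ofM; ring.
Qed.

Let J_ge x : - (L / c) ^+ 2 <= J x.
Proof.
have := Uc x; have := lL x; have := sre_norm (l x); rewrite -/(rnorm (l x)) /J.
set n := rnorm x; set u := rnorm (U x); set s := sre (l x) => h1 h2 h3.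
have sn : s <= L * n by exact: le_trans (ler_norm _) (le_trans h1 h2).
have cn : 0 <= c * n by rewrite mulr_ge0 ?rnorm_ge0// ltW.
have cu : (c * n) ^+ 2 <= u ^+ 2 by rewrite ler_sqr ?nnegrE// (le_trans cn).
have /eqP e : L / c * c == L by rewrite divfK// gt_eqF.
have := sqr_ge0 (c * n - L / c).
have -> : (c * n - L / c) ^+ 2 = (c * n) ^+ 2 + (L / c) ^+ 2 - 2 * ((L / c * c) * n).
  by ring.
by rewrite e; nra.
Qed.

Let d := inf (range J).

Let J_has_inf : has_inf (range J).
Proof.
split; first by exists (J 0), 0.
by exists (- (L / c) ^+ 2) => _ [x _ <-]; exact: J_ge.
Qed.

Let dJ x : d <= J x.
Proof. by apply: ge_inf; [exact: J_has_inf.2|exists x]. Qed.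

Let minimizing : exists u : nat -> H, forall n, J (u n) < d + n.+1%:R^-1.
Proof.
suff /choice[u uP] : forall n, exists x, J x < d + n.+1%:R^-1 by exists u.
move=> n; have n0 : 0 < n.+1%:R^-1 :> R by rewrite invr_gt0 ltr0n.
by have [_ [x _ <-] xd] := inf_adherent n0 J_has_inf; exists x.
Qed.

(** The parallelogram identity: near-minimizers of [J] are close. *)
Let near_minimizers (e : R) x y : J x <= d + e -> J y <= d + e ->
  rnorm (U (y - x)) ^+ 2 <= 4 * e.
Proof.
(* Expand [J] at the midpoint of [x] and [y]. *)
move=> xe ye; have := dJ (x + sofr k 2^-1 *: (y - x)).
have := JDZ x 1 (y - x); rewrite rmorph1 scale1r subrKC JDZ.
by move=> h1 h2; lra.
Qed.

(** The gradient of [J] is small at near-minimizers. *)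
Let near_critical (e : R) x h : 0 <= e -> J x <= d + e ->
  (g x h) ^+ 2 <= (rnorm (U h) ^+ 2 + 1) * e.
Proof.
move=> e0 xe; set b := rnorm (U h) ^+ 2; set a := g x h.
have b0 : 0 <= b by exact: sqr_ge0.
(* The minimizing step is [- a / b]; with [b + 1] no case [b = 0] is needed. *)
have b1 : b + 1 != 0 by rewrite gt_eqF// ltr_wpDl.
have := dJ (x + sofr k (- (a / (b + 1))) *: h); rewrite JDZ -/a -/b => h1.
have : 0 <= e - 2 * a ^+ 2 / (b + 1) + (a / (b + 1)) ^+ 2 * b.
  rewrite -subr_ge0 in xe; rewrite -subr_ge0 in h1.
  apply: le_trans (addr_ge0 xe h1) _; rewrite le_eqVlt; apply/orP; left.
  by apply/eqP; ring.
set t := a / (b + 1); have at_ : a = t * (b + 1) by rewrite /t divfK.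
have -> : 2 * a ^+ 2 / (b + 1) = 2 * t ^+ 2 * (b + 1).
  by rewrite /t; field.
rewrite at_ => h2.
have := sqr_ge0 t => t0.
rewrite exprMn [(b + 1) ^+ 2]expr2 mulrA mulrC ler_wpM2l//; first by rewrite addr_ge0.
by nra.
Qed.

(** A minimizer of [J x = |U x|^2 - 2 Re (l x)] represents [l] by the form
    [<U x, U z>]. *)
Lemma quadratic_functional_critical : exists z, forall x, '[U x, U z] = l x.
Proof.
have [u uP] := minimizing.
have inv_small (e : R) : 0 < e -> \forall n \near \oo, n.+1%:R^-1 < e.
  by move=> e0; exact: (near_infty_natSinv_lt (PosNum e0)).
have cu : cvgn u.
  apply: cauchy_cvg; apply: cauchy_exP => e e0.
  have e'0 : 0 < sre e by rewrite -(sofr_ltr k) rmorph0 sreK ?ltW.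
  have := @inv_small ((c * sre e) ^+ 2 / 4).
  case=> [|N _ /(_ N (leqnn N))/= Ne].
    by rewrite divr_gt0 ?exprn_gt0 ?mulr_gt0.
  exists (u N); exists N => // n /= Nn.
  rewrite -ball_normE/= -rnormK -(sreK (ltW e0)) sofr_ltr.
  rewrite -(ltr_pM2l c_gt0); apply: le_lt_trans (Uc _) _.
  have cs0 : 0 <= c * sre e by rewrite ltW// mulr_gt0.
  rewrite -(ltr_sqr (rnorm_ge0 _) cs0).
  apply: le_lt_trans (near_minimizers (e := N.+1%:R^-1) _ _) _.
  - apply/ltW/(lt_le_trans (uP n)).
    by rewrite lerD2l lef_pV2 ?posrE ?ltr0n// ler_nat.
  - exact/ltW/uP.
  - by rewrite mulrC -ltr_pdivlMr.
pose z := limn u.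
have gz h : g z h = 0.
  apply/eqP; case: (eqVneq (g z h) 0) => // g0.
  have a0 : 0 < `|g z h| / 2 by rewrite divr_gt0 ?normr_gt0.
  set a := `|g z h| / 2 in a0.
  (* [M] bounds the functional [g _ h]; adding 1 makes it positive. *)
  pose M := opnorm U * rnorm (U h) + 1.
  have M0 : 0 < M.
    by rewrite ltr_wpDl// mulr_ge0 ?rnorm_ge0 ?opnorm_ge0.
  pose b := rnorm (U h) ^+ 2 + 1.
  have b0 : 0 < b by rewrite ltr_wpDl// sqr_ge0.
  have /cvgrPdist_lt/(_ (sofr k (a / M))) : u n @[n --> \oo] --> z by [].
  rewrite -(rmorph0 (@sofr R k)) sofr_ltr divr_gt0// => /(_ isT) uz.
  have : \forall n \near \oo, False.
    near=> n.
    have h1 : rnorm (z - u n) < a / M.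
      by rewrite -(sofr_ltr k) rnormK; near: n.
    have h2 : n.+1%:R^-1 < a ^+ 2 / b.
      by near: n; apply: inv_small; rewrite divr_gt0 ?exprn_gt0.
    have n0 : 0 <= n.+1%:R^-1 :> R by rewrite invr_ge0.
    have h3 : (g (u n) h) ^+ 2 < a ^+ 2.
      apply: le_lt_trans (near_critical h n0 (ltW (uP n))) _.
      by rewrite -/b mulrC -ltr_pdivlMr.
    have h4 : `|g (u n) h| < a.
      by rewrite -(ltr_sqr (normr_ge0 _) (ltW a0)) real_normK ?num_real.
    have h5 : `|g z h - g (u n) h| < a.
      have -> : g z h - g (u n) h = sre '[U (z - u n), U h].
        by rewrite (linear_sub bU.1) innerBl raddfB/= /g; ring.
      apply: le_lt_trans (sre_norm _) _.
      apply: le_lt_trans (cauchy_schwarz _ _) _.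
      apply: (@le_lt_trans _ _ (M * rnorm (z - u n))).
        apply: (@le_trans _ _ (opnorm U * rnorm (z - u n) * rnorm (U h))).
          by rewrite ler_wpM2r ?rnorm_ge0 ?ler_opnorm.
        by rewrite mulrAC /M ler_wpM2r ?rnorm_ge0// lerDl.
      by rewrite mulrC -ltr_pdivlMr.
    have := ler_normD (g z h - g (u n) h) (g (u n) h).
    rewrite subrK => h6.
    have : `|g z h| < a + a by apply: le_lt_trans h6 _; exact: ltrD.
    by rewrite /a -splitr ltxx.
  by case=> N _ /(_ N (leqnn N)).
exists z => x; apply/eqP; rewrite -subr_eq0; apply/eqP.
(* The real part vanishes for every [x]; rotating [x] gives the full claim. *)
set D := _ - _.
have := gz (sconj D *: x).
rewrite /g -sre_conj -inner_conj.
rewrite (linear_scale bU.1) innerZl.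
have -> : l (sconj D *: x) = sconj D * l x by rewrite (scalable_linear ll).
rewrite -raddfB -mulrBr -/D [sconj D * D]mulrC -sqr_snorm -rnormK -rmorphXn/= sofrK.
by move=> /eqP; rewrite sqrf_eq0 => /eqP/rnorm_eq0.
Unshelve. all: by end_near. Qed.

End QuadraticFunctional.

Section Adjoint.
Context (R : realType) (k : scalar_kind).
Local Notation K := (scalar_field R k).

Lemma riesz (H : hilbertType R k) (l : H -> K) L : scalar l ->
  (forall x, rnorm (l x) <= L * rnorm x) -> exists z, forall x, '[x, z] = l x.
Proof.
move=> ll lL; apply: (@quadratic_functional_critical _ _ H H idfun l 1 L) => //.
- exact: bounded_operator_id.
- by move=> x; rewrite mul1r.
Qed.

Context (H : hilbertType R k) (F : innerType R k).
Implicit Types (T : H -> F).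

Lemma adjointP T x y : bounded_operator T -> '[T x, y] = '[x, adjoint T y].
Proof.
move=> bT; suff [z zP] : exists z, forall x, '[T x, y] = '[x, z].
  by move: x; rewrite /adjoint; case: xgetP => [p -> //|/(_ z)].
have [a u v|x'|z zP] := @riesz H (fun x => '[T x, y]) (opnorm T * rnorm y).
- by rewrite bT.1 innerDl innerZl.
- apply: le_trans (cauchy_schwarz _ _) _.
  by rewrite mulrAC ler_wpM2r ?rnorm_ge0 ?ler_opnorm.
- by exists z.
Qed.

Lemma adjoint_linear T : bounded_operator T -> linear (adjoint T).
Proof.
move=> bT a x y; apply: inner_ext => z.
by rewrite -adjointP// !innerDr !innerZr !adjointP.
Qed.

(** The hypothesis on [x] holds when [x] is the value at [y] of the adjoint
    of [T]. *)
Lemma ler_adjoint_value T b x y : 0 <= b ->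
  (forall z, rnorm (T z) <= b * rnorm z) -> '[T x, y] = '[x, x] ->
  rnorm x <= b * rnorm y.
Proof.
move=> b0 Tb e; apply: ler_rnorm_sqr => //.
rewrite rnorm_sqr -e; apply: le_trans (ler_norm _) _.
apply: le_trans (sre_norm _) _; apply: le_trans (cauchy_schwarz _ _) _.
by rewrite mulrAC ler_wpM2r ?rnorm_ge0.
Qed.

Lemma bounded_adjoint T : bounded_operator T -> bounded_operator (adjoint T).
Proof.
move=> bT; apply: (@bounded_operatorP _ _ _ _ _ (opnorm T)) => [|y].
  exact: adjoint_linear.
apply: (@ler_adjoint_value T); rewrite ?opnorm_ge0 ?adjointP// => x.
exact: ler_opnorm.
Qed.

Lemma opnorm_adjoint T : bounded_operator T -> opnorm (adjoint T) = opnorm T.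
Proof.
move=> bT; have bTa := bounded_adjoint bT.
apply/eqP; rewrite eq_le; apply/andP; split; apply: opnorm_le;
  rewrite ?opnorm_ge0// => x.
  apply: (@ler_adjoint_value T); rewrite ?opnorm_ge0 ?adjointP// => y.
  exact: ler_opnorm.
apply: ler_rnorm_sqr; rewrite ?opnorm_ge0//.
rewrite rnorm_sqr adjointP//; apply: le_trans (ler_norm _) _.
apply: le_trans (sre_norm _) _; apply: le_trans (cauchy_schwarz _ _) _.
by rewrite mulrC mulrAC ler_wpM2r ?rnorm_ge0 ?ler_opnorm.
Qed.

End Adjoint.

(** * Square summable sequences and analysis operators *)

Section Analysis.
Context (R : realType) (k : scalar_kind).
Local Notation K := (scalar_field R k).
Local Notation l2 := (l2 R k).

Lemma nneseriesE (u : nat -> R) : (forall n, 0 <= u n) -> cvgn (series u) ->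
  (\sum_(0 <= n <oo) (u n)%:E = (limn (series u))%:E)%E.
Proof.
move=> u0 cu; rewrite -EFin_lim//; congr (limn _).
by apply/funext => n /=; rewrite sumEFin.
Qed.

Lemma l2_rnorm_sqr (x : l2) :
  ((rnorm x ^+ 2)%:E = \sum_(0 <= n <oo) (rnorm (x n) ^+ 2)%:E)%E.
Proof.
rewrite nneseriesE; last exact: l2_cvg.
  by rewrite rnorm_sqr inner_l2E l2_innerE sofrK.
by move=> n; exact: sqr_ge0.
Qed.

Lemma inner_delta (x : l2) n : '[x, l2_delta R k n] = x n.
Proof.
rewrite inner_l2E; apply: cvg_lim => //; apply: cvg_near_cst; near=> m.
rewrite /series/= (bigD1_seq n)/= ?iota_uniq ?mem_index_iota//=; last first.
  by near: m; exact: nbhs_infty_gt.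
rewrite /l2_delta_fun eqxx rmorph1 mulr1 big1 ?addr0// => i /negbTE ->.
by rewrite rmorph0 mulr0.
Unshelve. all: by end_near. Qed.

Lemma sre_l2_inner_le (x y : l2) b :
  (forall N, \sum_(0 <= n < N) rnorm (x n) * rnorm (y n) <= b) ->
  sre '[x, y] <= b.
Proof.
move=> xyb; apply/ler_addgt0Pr => e e0.
have := @l2_inner_cvg _ _ x y.
move=> /cvgrPdist_lt/(_ (sofr k e)).
rewrite -(rmorph0 (@sofr R k)) sofr_ltr => /(_ e0)[N _ /(_ N (leqnn N))] /=.
rewrite -/(l2_inner x y) -inner_l2E -rnormK sofr_ltr.
set s := series _ N => se.
have -> : '[x, y] = s + ('[x, y] - s) by rewrite addrC subrK.
rewrite raddfD/= lerD//; last first.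
  exact: le_trans (le_trans (ler_norm _) (sre_norm _)) (ltW se).
apply: le_trans (xyb N); rewrite /s /series/= raddf_sum.
apply: ler_sum => i _; rewrite -(rnorm_conj (y i)) -rnormM.
exact: le_trans (ler_norm _) (sre_norm _).
Qed.

Context (H : hilbertType R k).
Implicit Types (X Y : nat -> H) (U V : H -> l2).

(** [U] is the analysis operator of the Bessel sequence [X], described by its
    coordinates. *)
Definition is_analysis X U : Prop :=
  bounded_operator U /\ forall f n, U f n = '[f, X n].

Lemma bessel_sumE X (U : H -> l2) f : (forall n, U f n = '[f, X n]) ->
  Defs.coef_sum X f = ((rnorm (U f)) ^+ 2)%:E.
Proof.
by move=> UX; rewrite l2_rnorm_sqr; apply: eq_eseriesr => n _; rewrite UX.
Qed.

Lemma is_analysis_bessel X U : is_analysis X U -> is_bessel X.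
Proof.
(* The bound of a Bessel sequence is required to be positive, hence the 1. *)
move=> [bU UX]; exists (opnorm U ^+ 2 + 1).
split; first by rewrite ltr_wpDl// sqr_ge0.
move=> f; rewrite (bessel_sumE (UX f)) lee_fin.
apply: (@le_trans _ _ (opnorm U ^+ 2 * rnorm f ^+ 2)).
  rewrite -exprMn ler_sqr ?nnegrE ?mulr_ge0 ?rnorm_ge0 ?opnorm_ge0//.
  exact: ler_opnorm.
by rewrite ler_wpM2r ?sqr_ge0// lerDl.
Qed.

Lemma bessel_sum_analysis X (M : R) : 0 <= M ->
  (forall f, (Defs.coef_sum X f <= (M * rnorm f ^+ 2)%:E)%E) ->
  is_analysis X (analysis X) /\
  forall f, rnorm (analysis X f) <= Num.sqrt M * rnorm f.
Proof.
move=> M0 XM.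
have aX f n : analysis X f n = '[f, X n].
  rewrite /analysis; have -> // := insubdK (0 : l2) (_ : _ \in @l2_pred R k).
  apply/asboolP; rewrite /square_summable.
  exact: le_lt_trans (XM f) (ltry _).
have nX f : rnorm (analysis X f) <= Num.sqrt M * rnorm f.
  have s0 : 0 <= Num.sqrt M * rnorm f by rewrite mulr_ge0 ?sqrtr_ge0 ?rnorm_ge0.
  rewrite -(ler_sqr (rnorm_ge0 _) s0) exprMn sqr_sqrtr//.
  by rewrite -lee_fin -(bessel_sumE (aX f)).
split=> //; split=> //; apply: bounded_operatorP nX => a x y.
apply/val_inj/funext => n.
rewrite -[RHS]/(a * analysis X x n + analysis X y n) -[LHS]/(analysis X _ n).
by rewrite !aX innerDl innerZl.
Qed.

Lemma bessel_analysis X : is_bessel X -> is_analysis X (analysis X).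
Proof. by move=> [M [M0 XM]]; have [] := bessel_sum_analysis (ltW M0) XM. Qed.

Lemma analysisE X U : is_analysis X U -> analysis X = U.
Proof.
move=> UX; have [_ aX] := bessel_analysis (is_analysis_bessel UX).
by apply/funext => f; apply/val_inj/funext => n; rewrite /= aX UX.2.
Qed.

Lemma is_analysisB X Y U V : is_analysis X U -> is_analysis Y V ->
  is_analysis (X \- Y) (U \- V).
Proof.
move=> [bU UX] [bV VY]; split=> [|f n]; first exact: bounded_operatorB.
by rewrite /= innerBr -UX -VY.
Qed.

Lemma fr_normE X U : is_analysis X U -> fr_norm X = opnorm U.
Proof.
move=> UX; rewrite /fr_norm /synthesis (analysisE UX) opnorm_adjoint//.
exact: UX.1.
Qed.

Lemma opnorm_synthesisB X Y U V b : 0 <= b ->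
  is_analysis X U -> is_analysis Y V ->
  (forall f, rnorm (U f - V f) <= b * rnorm f) ->
  opnorm (synthesis X \- synthesis Y) <= b.
Proof.
move=> b0 UX VY UVb; apply: opnorm_le => // c /=.
apply: (@ler_adjoint_value _ _ _ _ (U \- V)) => //=.
rewrite /synthesis (analysisE UX) (analysisE VY) innerBl.
by rewrite (adjointP _ _ UX.1) (adjointP _ _ VY.1) -innerBr.
Qed.

End Analysis.

(** * Frames, canonical duals and projections *)

Section Frame.
Context (R : realType) (k : scalar_kind) (H : hilbertType R k).
Local Notation l2 := (l2 R k).
Context (Phi : nat -> H) (c : R).
Hypotheses (bPhi : is_bessel Phi) (c_gt0 : 0 < c).
Hypothesis lower : forall f, c * rnorm f <= rnorm (analysis Phi f).

Local Notation U := (analysis Phi).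
Local Notation T := (synthesis Phi).
Local Notation S := (frame_operator Phi).
Local Notation iS := (inv_op (frame_operator Phi)).

Let bU : bounded_operator U := (bessel_analysis bPhi).1.

Let UE f n : U f n = '[f, Phi n] := (bessel_analysis bPhi).2 f n.

Lemma synthesisP f x : '[U f, x] = '[f, T x].
Proof. exact: adjointP. Qed.

Lemma bounded_synthesis : bounded_operator T.
Proof. exact: bounded_adjoint. Qed.

Let lT : linear T := bounded_synthesis.1.

Let frame_operator_injective : injective S.
Proof.
move=> x y Sxy; apply/eqP; rewrite -subr_eq0; apply/eqP/rnorm_eq0.
have : rnorm (U (x - y)) ^+ 2 = 0.
  rewrite rnorm_sqr synthesisP (linear_sub bU.1) (linear_sub lT).
  by rewrite -[T (U x)]/(S x) Sxy subrr inner0r raddf0.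
move=> /eqP; rewrite sqrf_eq0 => /eqP Uxy; apply/eqP.
rewrite eq_le rnorm_ge0 andbT -(ler_pM2l c_gt0) mulr0.
by apply: le_trans (lower _) _; rewrite Uxy.
Qed.

(** Solving [S z = y] amounts to minimizing [|U z|^2 - 2 Re <z, y>]. *)
Let frame_operator_surjective y : exists z, S z = y.
Proof.
have sy : scalar (fun x : H => '[x, y]).
  by move=> a u v; rewrite innerDl innerZl.
have yb x : rnorm '[x, y] <= rnorm y * rnorm x.
  by rewrite mulrC cauchy_schwarz.
have [z zP] := quadratic_functional_critical bU c_gt0 lower sy yb.
by exists z; apply: inner_ext => x; rewrite -synthesisP.
Qed.

Lemma inv_frame_operatorK : cancel S iS.
Proof.
move=> x; apply: (@pinvKV _ _ (fun=> 0) setT S); last by rewrite inE.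
by move=> ? ? _ _; exact: frame_operator_injective.
Qed.

Lemma frame_operatorK : cancel iS S.
Proof.
by move=> y; have [z <-] := frame_operator_surjective y; rewrite inv_frame_operatorK.
Qed.

Lemma inv_frame_operator_linear : linear iS.
Proof.
move=> a x y; apply: frame_operator_injective.
rewrite frame_operatorK /frame_operator/= bU.1 lT.
by rewrite -![T (U _)]/(S _) !frame_operatorK.
Qed.

Lemma inv_frame_operator_selfadjoint x y : '[iS x, y] = '[x, iS y].
Proof.
rewrite -{1}(frame_operatorK y) -{2}(frame_operatorK x).
by rewrite /frame_operator/= -synthesisP [RHS]inner_conj -synthesisP -inner_conj.
Qed.

(** The analysis operator [U S^-1] of the canonical dual frame. *)
Definition dual_analysis (y : H) : l2 := U (iS y).

Local Notation G := dual_analysis.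

Lemma dual_analysisE y n : G y n = '[y, iS (Phi n)].
Proof. by rewrite UE inv_frame_operator_selfadjoint. Qed.

Lemma synthesis_dual y : T (G y) = y.
Proof. exact: frame_operatorK. Qed.

Lemma dual_analysis_synthesis x : G (T (U x)) = U x.
Proof. by rewrite /G -[T (U x)]/(S x) inv_frame_operatorK. Qed.

Lemma ler_dual_analysis y : rnorm (G y) <= c^-1 * rnorm y.
Proof.
apply: ler_rnorm_sqr; first by rewrite invr_ge0 ltW.
rewrite rnorm_sqr {1}/G synthesisP synthesis_dual.
apply: le_trans (ler_norm _) (le_trans (sre_norm _) _).
apply: le_trans (cauchy_schwarz _ _) _.
rewrite mulrAC ler_wpM2r ?rnorm_ge0//.
by rewrite ler_pdivlMl//; exact: lower.
Qed.

Lemma ler_inv_frame_operator y : rnorm (iS y) <= c^-1 ^+ 2 * rnorm y.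
Proof.
rewrite -(ler_pM2l c_gt0) expr2 -mulrA [leRHS]mulrA mulfV ?gt_eqF// mul1r.
exact: le_trans (lower _) (ler_dual_analysis y).
Qed.

Lemma bounded_dual_analysis : bounded_operator G.
Proof.
apply: bounded_operatorP ler_dual_analysis => a x y.
by rewrite /G inv_frame_operator_linear bU.1.
Qed.

Lemma is_analysis_dual_seq Theta A : bounded_operator Theta ->
  bounded_operator A -> is_analysis (dual_seq Phi Theta A) (G \o A \+ Theta).
Proof.
move=> bTh bA; split=> [|f n].
  exact: bounded_operatorD (bounded_operator_comp bounded_dual_analysis bA) bTh.
rewrite /dual_seq innerDr -(adjointP _ _ bA) -(adjointP _ _ bTh) inner_delta.
by rewrite -dual_analysisE.
Qed.

Lemma synthesis_dual_seq Theta A f : ran_synthesis Phi Theta ->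
  T ((G \o A \+ Theta) f) = A f.
Proof. by move=> [_ T0]; rewrite /= (linear_add lT) synthesis_dual T0 addr0. Qed.

Lemma approx_dual_dual_seq Theta A : ran_synthesis Phi Theta ->
  bounded_operator A -> opnorm (idfun \- A) < 1 ->
  approx_dual Phi (dual_seq Phi Theta A).
Proof.
move=> rT bA A1; have aX := is_analysis_dual_seq rT.1 bA.
split; first exact: is_analysis_bessel aX.
rewrite (analysisE aX).
suff -> : T \o (G \o A \+ Theta) = A by [].
by apply/funext => f; exact: synthesis_dual_seq.
Qed.

Lemma inner_dual_analysis_ker y x : T x = 0 -> '[G y, x] = 0.
Proof. by move=> x0; rewrite synthesisP x0 inner0r. Qed.

Let ker_proj x : T (x - G (T x)) = 0.
Proof. by rewrite (linear_sub lT) synthesis_dual subrr. Qed.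

(** The projection onto [ker T] is [1 - U S^-1 T]; in particular it exists. *)
Lemma orth_proj_ker x : orth_proj (ker_op T) x = x - G (T x).
Proof.
rewrite /orth_proj; case: xgetP => [p _ [/= p0 pP]|/(_ (x - G (T x))) []]; last first.
  by split=> [|z z0]; [exact: ker_proj|rewrite subKr inner_dual_analysis_ker].
apply/eqP; rewrite -subr_eq0; apply/eqP.
set z := _ - _; have z0 : T z = 0 by rewrite (linear_sub lT) p0 ker_proj subrr.
apply: (@orthogonal_sub_eq0 _ _ _ (G (T x)) (x - p)); last exact: pP.
  by rewrite /z !opprB addrCA.
exact: inner_dual_analysis_ker.
Qed.

Let proj_pythagoras x :
  rnorm x ^+ 2 = rnorm (x - G (T x)) ^+ 2 + rnorm (G (T x)) ^+ 2.
Proof.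
have := pythagoras (inner_dual_analysis_ker (T x) (ker_proj x)).
by rewrite addrC subrK => ->; rewrite addrC.
Qed.

Lemma ler_proj_ker x : rnorm (x - G (T x)) <= rnorm x.
Proof.
by rewrite -(ler_sqr (rnorm_ge0 _) (rnorm_ge0 _)) [leRHS]proj_pythagoras lerDl sqr_ge0.
Qed.

Lemma ler_proj_ran x : rnorm (G (T x)) <= rnorm x.
Proof.
by rewrite -(ler_sqr (rnorm_ge0 _) (rnorm_ge0 _)) [leRHS]proj_pythagoras lerDr sqr_ge0.
Qed.

(** The projection onto [ker T] annihilates the range of [U]. *)
Lemma proj_ker_subU x z : x - G (T x) = (x - U z) - G (T (x - U z)).
Proof.
have := dual_analysis_synthesis z; move: (U z) => w GTw.
rewrite (linear_sub lT) (linear_sub bounded_dual_analysis.1) GTw.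
by rewrite opprB addrA subrK.
Qed.

Lemma ran_synthesis_proj V : bounded_operator V ->
  ran_synthesis Phi (orth_proj (ker_op T) \o V).
Proof.
move=> bV; have -> : orth_proj (ker_op T) \o V = V \- (G \o (T \o V)).
  by apply/funext => f; exact: orth_proj_ker.
split=> [|f]; last exact: ker_proj.
exact: (bounded_operatorB bV (bounded_operator_comp bounded_dual_analysis
  (bounded_operator_comp bounded_synthesis bV))).
Qed.

(** The component along the range of [U] of the difference of analysis operators
    is the same for all [Lambda]; the projection of [V] onto [ker T] cancels the
    component along [ker T]. *)
Lemma best_approx_proj A X V : bounded_operator A ->
  opnorm (idfun \- A) < 1 -> is_analysis X V ->
  best_approx Phi (orth_proj (ker_op T) \o V) A X.
Proof.
move=> bA A1 VX; have bV := VX.1.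
have rP := ran_synthesis_proj bV.
split; first exact: approx_dual_dual_seq.
move=> Lambda rL.
have aP := is_analysisB (is_analysis_dual_seq rP.1 bA) VX.
have aL := is_analysisB (is_analysis_dual_seq rL.1 bA) VX.
rewrite (fr_normE aP) (fr_normE aL); apply: opnorm_le.
  exact: opnorm_ge0 aL.1.
move=> f; apply: le_trans (ler_opnorm f aL.1).
set W := (X in rnorm (X f) <= _); set W' := (X in _ <= rnorm (X f)).
suff -> : W f = G (T (W' f)) by exact: ler_proj_ran.
rewrite /W /W' /= (linear_sub lT) (linear_add lT) rL.2 addr0 synthesis_dual.
rewrite (linear_sub bounded_dual_analysis.1) orth_proj_ker.
by rewrite addrA addrAC addrK.
Qed.

End Frame.

(** * Perturbation of frames and of their approximate duals *)

Section FramePerturbation.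
Context (R : realType) (k : scalar_kind) (H : hilbertType R k).
Implicit Types (Phi Psi X : nat -> H).

Lemma bessel_of_bounds m M Phi : frame_bounds m M Phi -> is_bessel Phi.
Proof. by move=> [_ M0 b]; exists M; split=> // f; have /andP[] := b f. Qed.

Lemma lower_of_bounds m M Phi f : frame_bounds m M Phi ->
  Num.sqrt m * rnorm f <= rnorm (analysis Phi f).
Proof.
move=> fb; have [m0 M0 b] := fb.
have [_ aP] := bessel_analysis (bessel_of_bounds fb).
have s0 : 0 <= Num.sqrt m * rnorm f by rewrite mulr_ge0 ?sqrtr_ge0 ?rnorm_ge0.
rewrite -(ler_sqr s0 (rnorm_ge0 _)) exprMn (sqr_sqrtr (ltW m0)).
by rewrite -lee_fin -(bessel_sumE (aP f)); have /andP[] := b f.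
Qed.

Lemma is_frame_of_lower (c : R) Phi : is_bessel Phi -> 0 < c ->
  (forall f, c * rnorm f <= rnorm (analysis Phi f)) -> is_frame Phi.
Proof.
move=> bPhi c0 lower; have [M [M0 PM]] := bPhi.
exists (c ^+ 2), M; split; rewrite ?exprn_gt0// => f; rewrite PM andbT.
rewrite (bessel_sumE ((bessel_analysis bPhi).2 f)) lee_fin -exprMn.
by rewrite ler_sqr ?nnegrE ?rnorm_ge0// mulr_ge0 ?rnorm_ge0// ltW.
Qed.

(** A sequence quadratically close to a Bessel sequence is Bessel, and the
    analysis operators are at distance at most [sqrt q]. *)
Lemma quad_close_analysis Phi Psi : is_bessel Phi -> quad_close Phi Psi ->
  is_bessel Psi /\ forall f, rnorm (analysis Phi f - analysis Psi f) <=
    Num.sqrt (fine (quad_sum Phi Psi)) * rnorm f.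
Proof.
move=> bPhi qc; set q := fine _.
have q_ge0 : (0 <= quad_sum Phi Psi)%E.
  by apply: nneseries_ge0 => n _ _; rewrite lee_fin sqr_ge0.
have qE : quad_sum Phi Psi = q%:E by rewrite fineK// ge0_fin_numE.
have q0 : 0 <= q by exact: fine_ge0.
have qD f : (Defs.coef_sum (Phi \- Psi)%R f <= (q * rnorm f ^+ 2)%:E)%E.
  rewrite mulrC EFinM -qE -nneseriesZl; last first.
    by move=> n _; rewrite lee_fin sqr_ge0.
  apply: lee_nneseries => n _; first by rewrite lee_fin sqr_ge0.
  rewrite -EFinM lee_fin -exprMn.
  by rewrite ler_sqr ?nnegrE ?mulr_ge0 ?rnorm_ge0//; exact: cauchy_schwarz.
have [aD nD] := bessel_sum_analysis q0 qD.
have aP := bessel_analysis bPhi.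
have := is_analysisB aP aD.
have -> : Phi \- (Phi \- Psi) = Psi by apply/funext => n /=; rewrite subKr.
move=> aQ; split=> [|f]; first exact: is_analysis_bessel aQ.
by rewrite (analysisE aQ) /= subKr.
Qed.

(** If [q0 < 1], the analysis operator of [Psi] is bounded below: expand
    [|f|^2 = <U f, U S^-1 f>] and replace the first [U] by that of [Psi]. *)
Lemma perturbed_lower_bound Phi Psi (c q0 : R) :
  is_bessel Phi -> is_bessel Psi -> 0 < c ->
  (forall f, c * rnorm f <= rnorm (analysis Phi f)) ->
  (forall N, \sum_(0 <= n < N)
     rnorm (Phi n - Psi n) * rnorm (inv_op (frame_operator Phi) (Phi n)) <= q0) ->
  forall f, c * (1 - q0) * rnorm f <= rnorm (analysis Psi f).
Proof.
move=> bPhi bPsi c0 lower q0P f.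
have [f0|f0] := eqVneq (rnorm f) 0; first by rewrite f0 mulr0 rnorm_ge0.
have f_gt0 : 0 < rnorm f by rewrite lt_neqAle eq_sym f0 rnorm_ge0.
rewrite -(ler_pM2r f_gt0) -!mulrA -ler_pdivlMl//.
set G := dual_analysis Phi f.
have e : '[f, f] = '[analysis Psi f, G] + '[analysis Phi f - analysis Psi f, G].
  rewrite -innerDl addrC subrK synthesisP//.
  by rewrite (synthesis_dual bPhi c0 lower).
have h1 : sre '[analysis Psi f, G] <= c^-1 * (rnorm (analysis Psi f) * rnorm f).
  apply: le_trans (ler_norm _) (le_trans (sre_norm _) _).
  apply: le_trans (cauchy_schwarz _ _) _.
  by rewrite mulrCA ler_wpM2l ?rnorm_ge0//; exact: ler_dual_analysis.
have h2 : sre '[analysis Phi f - analysis Psi f, G] <= q0 * rnorm f ^+ 2.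
  apply: sre_l2_inner_le => N.
  apply: le_trans (ler_wpM2r (sqr_ge0 _) (q0P N)).
  rewrite mulr_suml; apply: ler_sum => n _.
  have -> : l2_val (analysis Phi f - analysis Psi f) n = '[f, Phi n - Psi n].
    by rewrite innerBr -(bessel_analysis bPhi).2 -(bessel_analysis bPsi).2.
  rewrite (dual_analysisE bPhi c0 lower) expr2 [leRHS]mulrC mulrACA.
  by apply: ler_pM; rewrite ?rnorm_ge0//; exact: cauchy_schwarz.
have := rnorm_sqr f; rewrite e raddfD/= => h3.
have : rnorm f ^+ 2 - q0 * rnorm f ^+ 2 <= c^-1 * (rnorm (analysis Psi f) * rnorm f).
  by rewrite {1}h3 lerBlDr lerD.
by apply: le_trans; rewrite le_eqVlt; apply/orP; left; apply/eqP; ring.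
Qed.

Lemma ler_synthesisB Phi Psi b x : 0 <= b -> is_bessel Phi -> is_bessel Psi ->
  (forall f, rnorm (analysis Phi f - analysis Psi f) <= b * rnorm f) ->
  rnorm (synthesis Phi x - synthesis Psi x) <= b * rnorm x.
Proof.
move=> b0 bPhi bPsi D.
apply: (@ler_adjoint_value _ _ _ _ (analysis Phi \- analysis Psi)) => //=.
by rewrite innerBl !synthesisP// -innerBr.
Qed.

Section TwoFrames.
Context (Phi Psi : nat -> H) (c c' s : R) (A1 A2 : H -> H).
Hypotheses (bPhi : is_bessel Phi) (bPsi : is_bessel Psi).
Hypotheses (c_gt0 : 0 < c) (c'_gt0 : 0 < c') (s_ge0 : 0 <= s).
Hypothesis lPhi : forall f, c * rnorm f <= rnorm (analysis Phi f).
Hypothesis lPsi : forall f, c' * rnorm f <= rnorm (analysis Psi f).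
Hypothesis D : forall f, rnorm (analysis Phi f - analysis Psi f) <= s * rnorm f.
Hypotheses (bA1 : bounded_operator A1) (bA2 : bounded_operator A2).

Local Notation T1 := (synthesis Phi).
Local Notation T2 := (synthesis Psi).
Local Notation G1 := (dual_analysis Phi).
Local Notation G2 := (dual_analysis Psi).

(** As [T1 V = A1], the defect is [(T1 - T2) V - (A1 - A2)]. *)
Lemma ler_synthesis_defect V v f : T1 (V f) = A1 f -> rnorm (V f) <= v * rnorm f ->
  rnorm (A2 f - T2 (V f)) <= (s * v + opnorm (A1 \- A2)) * rnorm f.
Proof.
move=> TV Vv.
have -> : A2 f - T2 (V f) = (T1 (V f) - T2 (V f)) - (A1 \- A2) f.
  by rewrite /= TV opprB [RHS]addrC addrA subrK.
apply: le_trans (ler_rnormB _ _) _; rewrite mulrDl lerD//.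
  apply: le_trans (ler_synthesisB _ s_ge0 bPhi bPsi D) _.
  by rewrite -mulrA ler_wpM2l.
exact: ler_opnorm (bounded_operatorB bA1 bA2).
Qed.

Lemma ler_dual_seq_analysis Theta f : bounded_operator Theta ->
  rnorm ((G1 \o A1 \+ Theta) f) <= (opnorm A1 / c + opnorm Theta) * rnorm f.
Proof.
move=> bT; apply: le_trans (ler_rnormD _ _) _.
rewrite mulrDl lerD ?ler_opnorm//.
apply: le_trans (ler_dual_analysis bPhi c_gt0 lPhi _) _.
have i0 : 0 <= c^-1 by rewrite invr_ge0 ltW.
by rewrite [_ / c]mulrC -mulrA ler_wpM2l// ler_opnorm.
Qed.

(** With [V] the analysis operator of [X], the difference of the analysis
    operators is [G2 (A2 - T2 V)]. *)
Lemma dual_seq_perturbation Theta : ran_synthesis Phi Theta ->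
  let X := dual_seq Phi Theta A1 in
  perturbation
    (c'^-1 * (s * (opnorm A1 / c + opnorm Theta) + opnorm (A1 \- A2)))
    (dual_seq Psi (orth_proj (ker_op T2) \o analysis X) A2) X.
Proof.
move=> rT X; have bT := rT.1.
have aX : is_analysis X _ := is_analysis_dual_seq bPhi c_gt0 lPhi bT bA1.
have b0 : 0 <= s * (opnorm A1 / c + opnorm Theta) + opnorm (A1 \- A2).
  rewrite addr_ge0 ?mulr_ge0 ?addr_ge0 ?divr_ge0 ?(ltW c_gt0)//.
  - exact: opnorm_ge0 bA1.
  - exact: opnorm_ge0 bT.
  - exact: opnorm_ge0 (bounded_operatorB bA1 bA2).
rewrite (analysisE aX); set V := (_ \+ _).
have rP := ran_synthesis_proj bPsi c'_gt0 lPsi aX.1.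
have aY := is_analysis_dual_seq bPsi c'_gt0 lPsi rP.1 bA2.
have i'0 : 0 <= c'^-1 by rewrite invr_ge0 ltW.
split; [exact: is_analysis_bessel aY|exact: is_analysis_bessel aX|].
apply: (opnorm_synthesisB _ aY aX) => [|f]; first by rewrite mulr_ge0.
rewrite [X in rnorm X](_ : _ = G2 (A2 f - T2 (V f))).
  apply: le_trans (ler_dual_analysis bPsi c'_gt0 lPsi _) _.
  rewrite -mulrA ler_wpM2l//.
  apply: (@ler_synthesis_defect V); last exact: ler_dual_seq_analysis.
  exact: (synthesis_dual_seq bPhi c_gt0 lPhi A1 f rT).
rewrite (linear_sub (bounded_dual_analysis bPsi c'_gt0 lPsi).1).
rewrite -[X in X - _]/(G2 (A2 f) + orth_proj (ker_op T2) (V f)).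
by rewrite (orth_proj_ker bPsi c'_gt0 lPsi) addrA addrAC addrK.
Qed.

(** The difference of [G1 A1] and [G2 A2] splits into a component in the range of
    the analysis operator of [Psi] and a component in [ker T2]; for the latter
    [analysis Phi] may be replaced by [analysis Phi - analysis Psi]. *)
Lemma canonical_dual_seq_distance :
  fr_norm (dual_seq Phi (fun=> 0) A1 \- dual_seq Psi (fun=> 0) A2) <=
    s * c^-1 ^+ 2 * opnorm A1 + c'^-1 * (s * (opnorm A1 / c) + opnorm (A1 \- A2)).
Proof.
have b0 := bounded_operator0 H (l2 R k).
have oA := opnorm_ge0 bA1.
have oB := opnorm_ge0 (bounded_operatorB bA1 bA2).
have a1 := is_analysis_dual_seq bPhi c_gt0 lPhi b0 bA1.
have a2 := is_analysis_dual_seq bPsi c'_gt0 lPsi b0 bA2.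
rewrite (fr_normE (is_analysisB a1 a2)).
have i0 : 0 <= c^-1 by rewrite invr_ge0 ltW.
have i'0 : 0 <= c'^-1 by rewrite invr_ge0 ltW.
apply: opnorm_le => [|f].
  by rewrite addr_ge0// mulr_ge0// ?addr_ge0// ?mulr_ge0// sqr_ge0.
have lG2 := (bounded_dual_analysis bPsi c'_gt0 lPsi).1.
rewrite [X in rnorm X](_ : _ =
  (G1 (A1 f) - G2 (T2 (G1 (A1 f)))) - G2 (A2 f - T2 ((G1 \o A1) f))); last first.
  by rewrite /= !addr0 (linear_sub lG2) opprB addrA subrK.
apply: le_trans (ler_rnormB _ _) _; rewrite mulrDl lerD//; last first.
  apply: le_trans (ler_dual_analysis bPsi c'_gt0 lPsi _) _.
  rewrite -mulrA ler_wpM2l//; apply: (@ler_synthesis_defect (G1 \o A1)) => /=.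
    exact: (synthesis_dual bPhi c_gt0 lPhi (A1 f)).
  apply: le_trans (ler_dual_analysis bPhi c_gt0 lPhi _) _.
  by rewrite [_ / c]mulrC -mulrA ler_wpM2l// ler_opnorm.
set y := A1 f; set z := inv_op (frame_operator Phi) y.
rewrite (proj_ker_subU bPsi c'_gt0 lPsi (G1 y) z).
apply: le_trans (ler_proj_ker bPsi c'_gt0 lPsi _) _.
apply: le_trans (D z) _; rewrite -!mulrA ler_wpM2l//.
apply: le_trans (ler_inv_frame_operator bPhi c_gt0 lPhi y) _.
by rewrite expr2 -mulrA !ler_wpM2l// ler_opnorm.
Qed.

End TwoFrames.

End FramePerturbation.

Theorem theorem4p9 (R : realType) (k : scalar_kind) (H : hilbertType R k)
  (Hsep : separable H) (Phi Psi : nat -> H) (m : R) (A1 A2 : H -> H)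
  (hPhi : exists M : R, frame_bounds m M Phi)
  (bA1 : bounded_operator A1) (bA2 : bounded_operator A2)
  (hA1 : opnorm (idfun \- A1) < 1) (hA2 : opnorm (idfun \- A2) < 1)
  (hclose : c_quad_close m Phi Psi) (hq0 : (quad0_sum Phi Psi < 1)%E) :
  let q := fine (quad_sum Phi Psi) in
  let q0 := fine (quad0_sum Phi Psi) in
  [/\ is_frame Psi,
      forall Theta : H -> l2 R k, ran_synthesis Phi Theta ->
        let X := dual_seq Phi Theta A1 in
        let Theta_ba := orth_proj (ker_op (synthesis Psi)) \o analysis X in
        let v := Num.sqrt q / (Num.sqrt m * (1 - q0)) *
          (opnorm A1 / Num.sqrt m + opnorm Theta
           + opnorm (A1 \- A2) / Num.sqrt q) in
        [/\ ran_synthesis Psi Theta_ba,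
            best_approx Psi Theta_ba A2 X &
            perturbation v (dual_seq Psi Theta_ba A2) X] &
      fr_norm (dual_seq Phi (fun=> 0) A1 \- dual_seq Psi (fun=> 0) A2) <=
        1 / (Num.sqrt m * (1 - q0)) *
        (2 * opnorm A1 * Num.sqrt (q / m) + opnorm (A1 \- A2))].
Proof.
move=> q q0; have [M fb] := hPhi; have [m_gt0 _ _] := fb.
have bPhi := bessel_of_bounds fb.
have [qc mq _] := hclose.
have [bPsi D] := quad_close_analysis bPhi qc; rewrite -/q in D.
(* The condition [m <= q] serves to divide by [sqrt q]. *)
have q_gt0 : 0 < q.
  apply: (lt_le_trans m_gt0); rewrite -lee_fin fineK// ge0_fin_numE//.
  by apply: le_trans mq; rewrite lee_fin ltW.
have t_ge0 n :
    (0 <= (rnorm (Phi n - Psi n) * rnorm (inv_op (frame_operator Phi) (Phi n)))%:E)%E.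
  by rewrite lee_fin mulr_ge0 ?rnorm_ge0.
have Q0 : (0 <= quad0_sum Phi Psi)%E by apply: nneseries_ge0.
have q0E : quad0_sum Phi Psi = q0%:E.
  by rewrite fineK// ge0_fin_numE//; exact: lt_trans hq0 (ltry _).
have q0_ge0 : 0 <= q0 by exact: fine_ge0.
have q0_lt1 : 0 < 1 - q0 by rewrite subr_gt0 -lte_fin -q0E.
have q0P N : \sum_(0 <= n < N)
    rnorm (Phi n - Psi n) * rnorm (inv_op (frame_operator Phi) (Phi n)) <= q0.
  rewrite -lee_fin -q0E -sumEFin; apply: nneseries_lim_ge => n _ _.
  exact: t_ge0.
set c := Num.sqrt m; have c_gt0 : 0 < c by rewrite sqrtr_gt0.
have lPhi f := lower_of_bounds f fb; rewrite -/c in lPhi.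
set c' := c * (1 - q0); have c'_gt0 : 0 < c' by rewrite mulr_gt0.
have lPsi f : c' * rnorm f <= rnorm (analysis Psi f).
  exact: (perturbed_lower_bound bPhi bPsi c_gt0 lPhi q0P).
set s := Num.sqrt q in D *; have s_gt0 : 0 < s by rewrite sqrtr_gt0.
have s_neq0 : s != 0 by rewrite gt_eqF.
have c_neq0 : c != 0 by rewrite gt_eqF.
have q0_neq1 : 1 - q0 != 0 by rewrite gt_eqF.
split=> [|Theta rT X Theta_ba v|].
- exact: is_frame_of_lower lPsi.
- have aX : is_analysis X _ := is_analysis_dual_seq bPhi c_gt0 lPhi rT.1 bA1.
  have aX' : is_analysis X (analysis X) by rewrite (analysisE aX).
  split.
  + exact: (ran_synthesis_proj bPsi c'_gt0 lPsi aX'.1).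
  + exact: (best_approx_proj bPsi c'_gt0 lPsi bA2 hA2 aX').
  + have := dual_seq_perturbation bPhi bPsi c_gt0 c'_gt0 (ltW s_gt0) lPhi lPsi
      D bA1 bA2 rT.
    rewrite (_ : c'^-1 * _ = v)//.
    by rewrite /v /c'; field; rewrite s_neq0 c_neq0.
- apply: le_trans (canonical_dual_seq_distance bPhi bPsi c_gt0 c'_gt0 (ltW s_gt0)
    lPhi lPsi D bA1 bA2) _.
  rewrite sqrtrM ?(ltW q_gt0)// sqrtrV ?(ltW m_gt0)// -/s -/c.
  have oA := opnorm_ge0 bA1.
  set a := opnorm A1 in oA *; set b := opnorm (_ \- _).
  have -> : 1 / c' * (2 * a * (s / c) + b) =
      s * c^-1 * a * c'^-1 + c'^-1 * (s * (a / c) + b).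
    by rewrite /c'; field; rewrite c_neq0.
  rewrite lerD2r (_ : s * c^-1 ^+ 2 * a = s * c^-1 * a * c^-1); last by ring.
  apply: ler_wpM2l; first by rewrite !mulr_ge0 ?invr_ge0 ?(ltW s_gt0) ?(ltW c_gt0).
  by rewrite lef_pV2 ?posrE// /c' ler_piMr ?(ltW c_gt0)// lerBlDr lerDl.
Qed.
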